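(* Consider a federated learning system with $n$ clients, of which clients $1,\dots,m$ ($0\le m<n$) are malicious. All malicious clients are detected and removed, so that clients $m+1,\dots,n$ remain. Let $\mathcal{L}_i:\mathbb{R}^d\to\mathbb{R}$ be the (differentiable) loss function of client $i$. Suppose the following hold. (1) There are constants $\mu>0$ and $L>0$ such that for each client $i$ and all $\bm{w},\bm{w}'\in\mathbb{R}^d$, $$\langle\bm{w}-\bm{w}',\nabla\mathcal{L}_i(\bm{w})-\nabla\mathcal{L}_i(\bm{w}')\rangle\ge\mu\Vert\bm{w}-\bm{w}'\Vert^2,$$ $$\langle\bm{w}-\bm{w}',\nabla\mathcal{L}_i(\bm{w})-\nabla\mathcal{L}_i(\bm{w}')\rangle\ge\frac1L\Vert\nabla\mathcal{L}_i(\bm{w})-\nabla\mathcal{L}_i(\bm{w}')\Vert^2.$$ (2) There is a finite $M>0$ such that every approximated Hessian-vector product $\tilde{\bm{H}}_t^i(\hat{\bm{w}}_t-\bar{\bm{w}}_t)$ computed by the L-BFGS algorithm during FedRecover (client $i$, round $t$) satisfies $$\Vert\tilde{\bm{H}}_t^i(\hat{\bm{w}}_t-\bar{\bm{w}}_t)+\bar{\bm{g}}_t^i-\bm{g}_t^i\Vert\le M,\qquad \bm{g}_t^i=\nabla\mathcal{L}_i(\hat{\bm{w}}_t).$$ (3) FedAvg is used as the aggregation rule, the abnormality threshold is $\tau=\infty$ (abnormality fixing is not used), and the learning rate $\eta>0$ satisfies $\eta\le\min(\frac1\mu,\frac1L)$. Let $\hat{\bm{w}}_t$ and $\bm{w}_t$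 be the global models recovered in round $t$ by FedRecover and by train-from-scratch, respectively. Then for each round $t>0$, $$\Vert\hat{\bm{w}}_t-\bm{w}_t\Vert\le(\sqrt{1-\eta\mu})^t\,\Vert\hat{\bm{w}}_0-\bm{w}_0\Vert+\frac{1-(\sqrt{1-\eta\mu})^t}{1-\sqrt{1-\eta\mu}}\,\eta M.$$
   Context: $\Vert\cdot\Vert$ is the $\ell_2$ norm and $\langle\cdot,\cdot\rangle$ the inner product on $\mathbb{R}^d$. Setup. Client $i$ has a finite nonempty local dataset $D_i$. Let $D'=\bigcup_{i=m+1}^n D_i$ be the joint dataset of the remaining clients, with $|D'|=\sum_{i=m+1}^n|D_i|$. FedAvg over the remaining clients aggregates vectors $\bm{x}^{m+1},\dots,\bm{x}^n$ into $\sum_{i=m+1}^n\frac{|D_i|}{|D'|}\bm{x}^i$. Historical information. The server has stored, from the original (poisoned) training, the original global models $\bar{\bm{w}}_t\in\mathbb{R}^d$ and the original model updates $\bar{\bm{g}}_t^i\in\mathbb{R}^d$; for a benign client, $\bar{\bm{g}}_t^i=\nabla\mathcal{L}_i(\bar{\bm{w}}_t)$. The original global models may have been influenced arbitrarily by the malicious clients. Train-from-scratch. From an initial model $\bm{w}_0$, $$\bm{w}_{t+1}=\bm{w}_t-\eta\sum_{i=m+1}^n\frac{|D_i|}{|D'|}\nabla\mathcal{L}_i(\bm{w}_t).$$ FedRecover with FedAvg and $\tau=\infty$. Parameters: total number of rounds $T$, number of warm-up rounds $T_w$, correction period $T_c$, number of final tuning rounds $T_f$, and L-BFGS buffer size $s<T_w$.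 Start from $\hat{\bm{w}}_0=\bar{\bm{w}}_0$. For $t=0,1,\dots,T-1$: - Exact rounds: if $t<T_w$, or $(t-T_w+1)\bmod T_c=0$, or $t\ge T-T_f$, then $$\hat{\bm{w}}_{t+1}=\hat{\bm{w}}_t-\eta\sum_{i=m+1}^n\frac{|D_i|}{|D'|}\bm{g}_t^i,\qquad \bm{g}_t^i=\nabla\mathcal{L}_i(\hat{\bm{w}}_t).$$ - Estimated rounds: otherwise, $$\hat{\bm{w}}_{t+1}=\hat{\bm{w}}_t-\eta\sum_{i=m+1}^n\frac{|D_i|}{|D'|}\big[\tilde{\bm{H}}_t^i(\hat{\bm{w}}_t-\bar{\bm{w}}_t)+\bar{\bm{g}}_t^i\big].$$ L-BFGS. In an estimated round $t$, the vector $\tilde{\bm{H}}_t^i(\hat{\bm{w}}_t-\bar{\bm{w}}_t)\in\mathbb{R}^d$ is the output of the following procedure with $\bm{v}=\hat{\bm{w}}_t-\bar{\bm{w}}_t$. Let $b_1<\dots<b_s$ be the $s$ most recent exact rounds before $t$, and put $\Delta\bm{w}_b=\hat{\bm{w}}_b-\bar{\bm{w}}_b$, $\Delta\bm{g}_b^i=\bm{g}_b^i-\bar{\bm{g}}_b^i$, $\Delta\bm{W}=[\Delta\bm{w}_{b_1},\dots,\Delta\bm{w}_{b_s}]$, $\Delta\bm{G}=[\Delta\bm{g}_{b_1}^i,\dots,\Delta\bm{g}_{b_s}^i]$. Let $\bm{A}=\Delta\bm{W}^T\Delta\bm{G}$, let $\bm{D}$ be the diagonal matrix of $\bm{A}$,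 let $\bm{L}$ be the lower triangular matrix of $\bm{A}$ (unrelated to the constant $L$), and let $\sigma=\big((\Delta\bm{g}_{b_{s-1}}^i)^T\Delta\bm{w}_{b_{s-1}}\big)/\big(\Delta\bm{w}_{b_{s-1}}^T\Delta\bm{w}_{b_{s-1}}\big)$. Set $$\bm{p}=\begin{bmatrix}-\bm{D}&\bm{L}^T\\ \bm{L}&\sigma\Delta\bm{W}^T\Delta\bm{W}\end{bmatrix}^{-1}\begin{bmatrix}\Delta\bm{G}^T\bm{v}\\ \sigma\Delta\bm{W}^T\bm{v}\end{bmatrix},$$ and output $\sigma\bm{v}-[\Delta\bm{G}\ \ \sigma\Delta\bm{W}]\,\bm{p}$. These outputs are assumed to be well defined whenever they are used; the only property of them assumed in the theorem is the bound in hypothesis (2). *)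

(* Defs.v *)
From mathcomp Require Import all_boot all_order all_algebra finmap.
From mathcomp Require Import all_classical all_reals all_analysis.

Set Implicit Arguments.
Unset Strict Implicit.
Unset Printing Implicit Defensive.

Import Order.TTheory GRing.Theory Num.Theory.
Import numFieldNormedType.Exports.
Local Open Scope ring_scope.

Definition dotv (R : realType) (d : nat) (u v : 'cV[R]_d) : R :=
  \sum_(j < d) u j 0 * v j 0.

(* The library norm `|u| on matrices is the sup norm. *)
Definition l2norm (R : realType) (d : nat) (u : 'cV[R]_d) : R :=
  Num.sqrt (dotv u u).

(* Meaningful where f is differentiable (a derivative that does not exist has
   an unspecified value). *)
Definition grad (R : realType) (d : nat) (f : 'cV[R]_d -> R) (w : 'cV[R]_d) :
    'cV[R]_d :=
  \col_(j < d) 'D_(delta_mx j 0) f w.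

(* Clients are indexed from 0 by 'I_n: the clients i < m are the malicious ones
   and the clients m <= i are the remaining ones. *)
Definition joint_data (X : choiceType) (m n : nat) (D : 'I_n -> {fset X}) :
    {fset X} :=
  \big[fsetU/fset0]_(i < n | (m <= i)%N) D i.

Definition fedavg (R : realType) (d : nat) (X : choiceType) (m n : nat)
    (D : 'I_n -> {fset X}) (x : 'I_n -> 'cV[R]_d) : 'cV[R]_d :=
  \sum_(i < n | (m <= i)%N)
    ((#|` D i|)%:R / (#|` joint_data m D|)%:R) *: x i.

Definition train_from_scratch (R : realType) (d : nat) (X : choiceType)
    (m n : nat) (D : 'I_n -> {fset X}) (loss : 'I_n -> 'cV[R]_d -> R)
    (eta : R) (w : nat -> 'cV[R]_d) : Prop :=
  forall t, w t.+1 = w t - eta *: fedavg m D (fun i => grad (loss i) (w t)).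

(* L-BFGS. The buffer is given by its columns: dw k and dg k, for k < s, are the
   differences of models and of gradients at the (k+1)-st oldest buffered round.
   Hence the second most recent round is the one of index s - 2. *)
Definition buf_mx (R : realType) (d s : nat) (x : nat -> 'cV[R]_d) :
    'M[R]_(d, s) :=
  \matrix_(j < d, k < s) x k j 0.

Definition lbfgs_sigma (R : realType) (d s : nat) (dw dg : nat -> 'cV[R]_d) :
    R :=
  dotv (dg (s - 2)%N) (dw (s - 2)%N) / dotv (dw (s - 2)%N) (dw (s - 2)%N).

Definition diag_part (R : realType) (s : nat) (A : 'M[R]_s) : 'M[R]_s :=
  \matrix_(j, k) (if j == k then A j k else 0).

(* The diagonal is included, as in tril. *)
Definition lower_part (R : realType) (s : nat) (A : 'M[R]_s) : 'M[R]_s :=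
  \matrix_(j, k) (if (k <= j)%N then A j k else 0).

Definition lbfgs_mx (R : realType) (d s : nat) (dw dg : nat -> 'cV[R]_d) :
    'M[R]_(s + s) :=
  let W := buf_mx s dw in
  let G := buf_mx s dg in
  let A := W^T *m G in
  block_mx (- diag_part A) (lower_part A)^T
           (lower_part A) (lbfgs_sigma s dw dg *: (W^T *m W)).

(* Division by 0 and the inverse of a singular matrix are total operations in
   the library; this says that neither occurs in [lbfgs], and that the buffer
   does have a second most recent round. *)
Definition lbfgs_defined (R : realType) (d s : nat) (dw dg : nat -> 'cV[R]_d) :
    Prop :=
  [/\ (1 < s)%N, dotv (dw (s - 2)%N) (dw (s - 2)%N) != 0
    & lbfgs_mx s dw dg \in unitmx].

Definition lbfgs (R : realType) (d s : nat) (dw dg : nat -> 'cV[R]_d)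
    (v : 'cV[R]_d) : 'cV[R]_d :=
  let W := buf_mx s dw in
  let G := buf_mx s dg in
  let sigma := lbfgs_sigma s dw dg in
  let p := invmx (lbfgs_mx s dw dg)
             *m col_mx (G^T *m v) (sigma *: (W^T *m v)) in
  sigma *: v - row_mx G (sigma *: W) *m p.

(* T: rounds, Tw: warm-up rounds, Tc: correction period, Tf: final tuning
   rounds. The truncated subtractions are harmless: t - Tw only matters when
   Tw <= t, and if T < Tf then every t satisfies T - Tf <= t over the integers
   as well. *)
Definition exact_round (T Tw Tc Tf t : nat) : bool :=
  [|| (t < Tw)%N, ((t - Tw + 1) %% Tc == 0)%N | (T - Tf <= t)%N].

(* The s most recent exact rounds before t, in increasing order. *)
Definition buffered_rounds (T Tw Tc Tf s t : nat) : seq nat :=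
  let e := [seq b <- iota 0 t | exact_round T Tw Tc Tf b] in
  drop (size e - s)%N e.

Section FedRecover.

Context (R : realType) (d : nat).

Definition delta_w (T Tw Tc Tf s : nat) (wbar what : nat -> 'cV[R]_d)
    (t k : nat) : 'cV[R]_d :=
  let b := nth 0%N (buffered_rounds T Tw Tc Tf s t) k in
  what b - wbar b.

Definition delta_g (T Tw Tc Tf s : nat) (n : nat)
    (loss : 'I_n -> 'cV[R]_d -> R) (gbar : nat -> 'I_n -> 'cV[R]_d)
    (what : nat -> 'cV[R]_d) (i : 'I_n) (t k : nat) : 'cV[R]_d :=
  let b := nth 0%N (buffered_rounds T Tw Tc Tf s t) k in
  grad (loss i) (what b) - gbar b i.

(* The approximated Hessian-vector product of client i in round t, applied to
   the vector what t - wbar t. *)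
Definition hvp (T Tw Tc Tf s : nat) (n : nat)
    (loss : 'I_n -> 'cV[R]_d -> R) (wbar : nat -> 'cV[R]_d)
    (gbar : nat -> 'I_n -> 'cV[R]_d) (what : nat -> 'cV[R]_d)
    (i : 'I_n) (t : nat) : 'cV[R]_d :=
  lbfgs s (delta_w T Tw Tc Tf s wbar what t)
          (delta_g T Tw Tc Tf s loss gbar what i t)
          (what t - wbar t).

(* The terms what 0, ..., what T are the models recovered by FedRecover with
   FedAvg and without abnormality fixing; the right-hand side of round t only
   involves what 0, ..., what t. *)
Definition fedrecover (T Tw Tc Tf s : nat) (X : choiceType) (m n : nat)
    (D : 'I_n -> {fset X}) (loss : 'I_n -> 'cV[R]_d -> R) (eta : R)
    (wbar : nat -> 'cV[R]_d) (gbar : nat -> 'I_n -> 'cV[R]_d)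
    (what : nat -> 'cV[R]_d) : Prop :=
  what 0%N = wbar 0%N /\
  forall t, (t < T)%N ->
    what t.+1 = what t - eta *: fedavg m D (fun i =>
      if exact_round T Tw Tc Tf t then grad (loss i) (what t)
      else hvp T Tw Tc Tf s loss wbar gbar what i t + gbar t i).

End FedRecover.

(* Main.v *)
(* The FedAvg weights form a convex combination, so the difference of the two
   models after a round is an average, over the remaining clients, of an exact
   gradient-descent difference minus eta times an estimation error of norm at
   most M. Co-coercivity absorbs the second-order term of a gradient step
   (eta <= 1/L), after which strong monotonicity makes the step contract
   distances by rho = sqrt (1 - eta mu). Hence the distance a_t satisfies
   a_(t+1) <= rho a_t + eta M, and a geometric sum concludes. *)
Require Import Defs.
From mathcomp Require Import all_boot all_order all_algebra finmap.
From mathcomp Require Import all_classical all_reals all_analysis.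
From mathcomp Require Import ring lra.
Set Implicit Arguments.
Unset Strict Implicit.
Unset Printing Implicit Defensive.

Import Order.TTheory GRing.Theory Num.Theory.
Import numFieldNormedType.Exports.
Local Open Scope ring_scope.

Section DotProduct.
Context {R : realType} {d : nat}.
Implicit Types (u v x : 'cV[R]_d) (a : R).

Lemma dotvC u v : dotv u v = dotv v u.
Proof. by apply: eq_bigr => j _; rewrite mulrC. Qed.

Lemma dotvDl u v x : dotv (u + v) x = dotv u x + dotv v x.
Proof. by rewrite -big_split; apply: eq_bigr => j _; rewrite mxE mulrDl. Qed.

Lemma dotvZl a u v : dotv (a *: u) v = a * dotv u v.
Proof. by rewrite mulr_sumr; apply: eq_bigr => j _; rewrite mxE mulrA. Qed.

Lemma dotvDr u v x : dotv x (u + v) = dotv x u + dotv x v.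
Proof. by rewrite !(dotvC x) dotvDl. Qed.

Lemma dotvZr a u v : dotv u (a *: v) = a * dotv u v.
Proof. by rewrite !(dotvC u) dotvZl. Qed.

Lemma dotvv_ge0 u : 0 <= dotv u u.
Proof. by apply: sumr_ge0 => j _; rewrite -expr2 sqr_ge0. Qed.

Lemma dotvv_eq0 u : dotv u u = 0 -> u = 0.
Proof.
move=> /eqP; rewrite psumr_eq0 => [/allP u0|j _]; last by rewrite -expr2 sqr_ge0.
apply/colP => j; rewrite mxE; apply/eqP.
by have := u0 j (mem_index_enum _); rewrite mulf_eq0 orbb.
Qed.

Lemma l2norm_ge0 u : 0 <= l2norm u.
Proof. exact: sqrtr_ge0. Qed.

Lemma sqr_l2norm u : l2norm u ^+ 2 = dotv u u.
Proof. exact/sqr_sqrtr/dotvv_ge0. Qed.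

Lemma l2norm0 : l2norm (0 : 'cV[R]_d) = 0.
Proof. by rewrite /l2norm /dotv big1 ?sqrtr0 // => j _; rewrite mxE mul0r. Qed.

Lemma l2normZ a u : l2norm (a *: u) = `|a| * l2norm u.
Proof.
by rewrite /l2norm dotvZl dotvZr mulrA -expr2 sqrtrM ?sqr_ge0// sqrtr_sqr.
Qed.

Lemma dotv_CauchySchwarz u v : dotv u v <= l2norm u * l2norm v.
Proof.
have [v0|v_neq0] := eqVneq (dotv v v) 0.
  rewrite (dotvv_eq0 v0) l2norm0 mulr0 /dotv big1// => j _.
  by rewrite mxE mulr0.
have v_gt0 : 0 < dotv v v by rewrite lt_def v_neq0 dotvv_ge0.
(* Up to the factor [dotv v v], this vector is the component of [u] orthogonal to [v]; the scaling
   avoids a division. *)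
have := dotvv_ge0 (dotv v v *: u + (- dotv u v) *: v).
have -> : dotv (dotv v v *: u + (- dotv u v) *: v)
    (dotv v v *: u + (- dotv u v) *: v) =
    dotv v v * (dotv u u * dotv v v - dotv u v ^+ 2).
  rewrite !(dotvDl, dotvDr, dotvZl, dotvZr) (dotvC v u); ring.
rewrite pmulr_rge0// subr_ge0 => CS.
apply: le_trans (ler_norm _) _.
by rewrite -sqrtr_sqr -sqrtrM ?dotvv_ge0// ler_wsqrtr.
Qed.

Lemma l2normD u v : l2norm (u + v) <= l2norm u + l2norm v.
Proof.
rewrite -ler_sqr ?nnegrE ?addr_ge0 ?l2norm_ge0//.
rewrite sqrrD !sqr_l2norm !(dotvDl, dotvDr) (dotvC v u).
have := dotv_CauchySchwarz u v; lra.
Qed.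

Lemma l2norm_sum (I : Type) (r : seq I) (P : pred I) (x : I -> 'cV[R]_d) :
  l2norm (\sum_(i <- r | P i) x i) <= \sum_(i <- r | P i) l2norm (x i).
Proof.
elim/big_ind2: _ => [|u a v b ua vb|//]; first by rewrite l2norm0.
exact: le_trans (l2normD _ _) (lerD ua vb).
Qed.

(** In the expanded square, the cross term is two copies of [eta * dotv u g]. One absorbs
    [eta ^+ 2 * dotv g g], by co-coercivity and [eta <= L^-1]; the other yields the decrease
    [eta * mu * dotv u u]. *)
Lemma gradient_step_contraction (mu L eta : R) (u g : 'cV[R]_d) :
  0 < mu -> 0 < L -> 0 < eta -> eta <= Num.min mu^-1 L^-1 ->
  mu * l2norm u ^+ 2 <= dotv u g -> L^-1 * l2norm g ^+ 2 <= dotv u g ->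
  l2norm (u - eta *: g) <= Num.sqrt (1 - eta * mu) * l2norm u.
Proof.
move=> mu0 L0 eta0; rewrite le_min => /andP[eta_mu eta_L] convex smooth.
(* [Num.sqrt] vanishes on negative reals, so squaring [rho] gives back [1 - eta * mu] only thanks to
   [eta <= mu^-1]. *)
have eta_mu1 : 0 <= 1 - eta * mu by rewrite subr_ge0 -ler_pdivlMr// mul1r.
rewrite -ler_sqr ?nnegrE ?mulr_ge0 ?sqrtr_ge0//.
rewrite exprMn; rewrite !sqr_l2norm in convex smooth *; rewrite sqr_sqrtr//.
rewrite -scaleNr !(dotvDl, dotvDr, dotvZl, dotvZr) (dotvC g u).
have eta_g : eta * dotv g g <= dotv u g.
  by apply: le_trans smooth; rewrite ler_wpM2r ?dotvv_ge0.
have := ler_wpM2l (ltW eta0) eta_g; have := ler_wpM2l (ltW eta0) convex; lra.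
Qed.

End DotProduct.

Section FedAvg.
Context {R : realType} {d m n : nat} {X : choiceType} (D : 'I_n -> {fset X}).
Implicit Types x y : 'I_n -> 'cV[R]_d.

Lemma fedavgB x y :
  fedavg m D x - fedavg m D y = fedavg m D (fun i => x i - y i).
Proof. by rewrite -sumrB; apply: eq_bigr => i _; rewrite scalerBr. Qed.

Lemma fedavgZ (a : R) x : a *: fedavg m D x = fedavg m D (fun i => a *: x i).
Proof.
by rewrite scaler_sumr; apply: eq_bigr => i _; rewrite !scalerA mulrC.
Qed.

Context (joint_gt0 : (0 < #|` joint_data m D|)%N).
Context (card_joint :
  #|` joint_data m D| = (\sum_(i < n | (m <= i)%N) #|` D i|)%N).

(** The denominator is the size of a union; [card_joint] makes it the sum of the numerators. *)
Lemma fedavg_weights :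
  \sum_(i < n | (m <= i)%N)
    (#|` D i|%:R / #|` joint_data m D|%:R : R) = 1.
Proof.
by rewrite -mulr_suml -natr_sum -card_joint divff// pnatr_eq0 -lt0n.
Qed.

Lemma fedavg_cst (c : 'cV[R]_d) : fedavg m D (fun=> c) = c.
Proof. by rewrite /fedavg -scaler_suml fedavg_weights scale1r. Qed.

Lemma l2norm_fedavg x (B : R) :
  (forall i : 'I_n, (m <= i)%N -> l2norm (x i) <= B) -> l2norm (fedavg m D x) <= B.
Proof.
move=> xB; apply: le_trans (l2norm_sum _ _ _) _.
rewrite -[leRHS]mul1r -[X in _ <= X * _]fedavg_weights mulr_suml; apply: ler_sum => i mi.
by rewrite l2normZ ger0_norm ?divr_ge0// ler_wpM2l ?divr_ge0 ?xB.
Qed.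

End FedAvg.

Lemma joint_data_gt0 (X : choiceType) (m n : nat) (D : 'I_n -> {fset X}) :
  (m < n)%N -> (forall i, D i != fset0) ->
  #|` joint_data m D| = (\sum_(i < n | (m <= i)%N) #|` D i|)%N ->
  (0 < #|` joint_data m D|)%N.
Proof.
move=> mn D0 ->; rewrite (bigD1 (Ordinal mn))//=.
by rewrite addn_gt0 cardfs_gt0 D0.
Qed.

(** The right-hand side solves the recurrence with equality, so induction propagates the bound. The
    horizon [T] is there because FedRecover constrains its models only up to round [T]. *)
Lemma affine_recurrence_bound (R : realType) (rho c : R) (a : nat -> R) (T : nat) :
  0 <= rho -> rho != 1 ->
  (forall t, (t < T)%N -> a t.+1 <= rho * a t + c) ->
  forall t, (t <= T)%N ->
    a t <= rho ^+ t * a 0%N + (1 - rho ^+ t) / (1 - rho) * c.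
Proof.
move=> rho0 rho1 step; elim=> [_|t IH tT].
  by rewrite expr0 subrr mul1r !mul0r addr0.
apply: le_trans (step _ tT) _.
apply: le_trans (lerD (ler_wpM2l rho0 (IH (ltnW tT))) (lexx c)) _.
rewrite le_eqVlt; apply/orP; left; apply/eqP; rewrite exprS.
by field; rewrite subr_eq0 eq_sym.
Qed.

Theorem theorem1 (R : realType) (d m n : nat) (hmn : (m < n)%N)
  (X : choiceType) (D : 'I_n -> {fset X})
  (hD : forall i : 'I_n, D i != fset0)
  (hD' : #|` joint_data m D| = (\sum_(i < n | (m <= i)%N) #|` D i|)%N)
  (loss : 'I_n -> 'cV[R]_d -> R)
  (hloss : forall (i : 'I_n) (w : 'cV[R]_d), differentiable (loss i) w)
  (* hypothesis (1) *)
  (mu L : R) (hmu : 0 < mu) (hL : 0 < L)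
  (hconvex : forall (i : 'I_n) (w w' : 'cV[R]_d),
    mu * l2norm (w - w') ^+ 2
      <= dotv (w - w') (grad (loss i) w - grad (loss i) w'))
  (hsmooth : forall (i : 'I_n) (w w' : 'cV[R]_d),
    L^-1 * l2norm (grad (loss i) w - grad (loss i) w') ^+ 2
      <= dotv (w - w') (grad (loss i) w - grad (loss i) w'))
  (* learning rate, hypothesis (3) *)
  (eta : R) (heta : 0 < eta) (hetale : eta <= Num.min mu^-1 L^-1)
  (* parameters of FedRecover *)
  (T Tw Tc Tf s : nat) (hTc : (0 < Tc)%N) (hs : (s < Tw)%N)
  (* historical information *)
  (wbar : nat -> 'cV[R]_d) (gbar : nat -> 'I_n -> 'cV[R]_d)
  (hgbar : forall (t : nat) (i : 'I_n), (t < T)%N -> (m <= i)%N ->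
    gbar t i = grad (loss i) (wbar t))
  (* the two recovered sequences of global models *)
  (w what : nat -> 'cV[R]_d)
  (hw : train_from_scratch m D loss eta w)
  (hwhat : fedrecover T Tw Tc Tf s m D loss eta wbar gbar what)
  (* the outputs of L-BFGS are well defined whenever they are used *)
  (hdef : forall (t : nat) (i : 'I_n), (t < T)%N -> (m <= i)%N ->
    ~~ exact_round T Tw Tc Tf t ->
    lbfgs_defined s (delta_w T Tw Tc Tf s wbar what t)
                    (delta_g T Tw Tc Tf s loss gbar what i t))
  (* hypothesis (2) *)
  (M : R) (hM : 0 < M)
  (hhvp : forall (t : nat) (i : 'I_n), (t < T)%N -> (m <= i)%N ->
    ~~ exact_round T Tw Tc Tf t ->
    l2norm (hvp T Tw Tc Tf s loss wbar gbar what i t + gbar t i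
            - grad (loss i) (what t)) <= M) :
  forall t : nat, (0 < t <= T)%N ->
    l2norm (what t - w t)
      <= Num.sqrt (1 - eta * mu) ^+ t * l2norm (what 0%N - w 0%N)
         + (1 - Num.sqrt (1 - eta * mu) ^+ t) / (1 - Num.sqrt (1 - eta * mu))
           * (eta * M).
Proof.
move=> t /andP[_]; move: t.
have joint0 := joint_data_gt0 hmn hD hD'.
(* Strict positivity of [eta * mu] keeps the geometric quotient away from [0 / 0]. *)
have rho1 : Num.sqrt (1 - eta * mu) != 1.
  rewrite lt_eqF// -[ltRHS]sqrtr1 ltr_sqrt// gtrBl.
  exact: mulr_gt0.
apply: (affine_recurrence_bound (a := fun k => l2norm (what k - w k))
  (sqrtr_ge0 _) rho1) => // t tT.
rewrite hw (hwhat.2 _ tT).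
set h := fun i => if exact_round _ _ _ _ _ then _ else _.
set g := fun i => grad _ _.
(* The current difference is the average of a constant family, so the whole update becomes a single
   average that can be bounded client by client. *)
have -> : what t - eta *: fedavg m D h - (w t - eta *: fedavg m D g) =
    fedavg m D (fun i => (what t - w t) - eta *: (h i - g i)).
  rewrite -fedavgB fedavg_cst// -fedavgZ -fedavgB scalerBr.
  by rewrite !opprB ![_ *: _ - _]addrC addrACA.
apply: l2norm_fedavg => // i mi.
(* Inserting the exact gradient at [what t] separates the contracting gradient step from the
   estimation error. *)
have -> : what t - w t - eta *: (h i - g i) =
    ((what t - w t) - eta *: (grad (loss i) (what t) - grad (loss i) (w t)))
    - eta *: (h i - grad (loss i) (what t)).
  rewrite -[RHS]addrA -opprD -scalerDr; congr (_ - _ *: _).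
  by rewrite [RHS]addrC subrKA.
apply: le_trans (l2normD _ _) (lerD _ _).
  exact: (gradient_step_contraction (L := L)).
rewrite -scaleNr l2normZ normrN gtr0_norm// ler_pM2l// /h.
(* The error is zero in an exact round and at most [M] in an estimated one. *)
case: ifPn => [_|/(hhvp _ _ tT mi)//].
by rewrite subrr l2norm0 ltW.
Qed.
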